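(* Let $m\geq2$ be a power of two, let $a\geq4$ be an integer, and let $c\in\mathbb R$ satisfy $2+\frac1a<c<a$. Then there is a $4$-permutable set $S_{m,a,c}\subseteq\mathbb Z$ such that $$\underline d_{\mathbb Z}(S_{m,a,c})=1-\frac{a(c-1)}{2mc(a-1)}.$$
   Context: An $\omega$-permutation of a countably infinite set $S$ of integers is a sequence $p_0,p_1,\ldots$ of elements of $S$ in which every element of $S$ occurs exactly once. It contains a monotone arithmetic progression of length $\ell$ if there are indices $i_0<i_1<\cdots<i_{\ell-1}$, $x\in\mathbb Z$ and $d\in\mathbb Z\setminus\{0\}$ such that $p_{i_j}=x+jd$ for all $0\leq j<\ell$. A countably infinite set $S$ is $\ell$-permutable if it has an $\omega$-permutation containing no monotone arithmetic progression of length $\ell$. For $T\subseteq\mathbb Z$, $\underline d_{\mathbb Z}(T)=\liminf_{n\to\infty}|T\cap[-n,n]|/(2n+1)$. *)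

(* Defs.v *)
From mathcomp Require Import all_boot all_order all_algebra finmap.
From mathcomp Require Import boolp classical_sets functions cardinality.
From mathcomp Require Import reals ereal topology normedtype sequences.
Set Implicit Arguments.
Unset Strict Implicit.
Unset Printing Implicit Defensive.
Import Order.TTheory GRing.Theory Num.Theory.
Import numFieldNormedType.Exports.
Local Open Scope classical_set_scope.
Local Open Scope ring_scope.

Definition omega_permutation (S : set int) (p : nat -> int) : Prop :=
  set_bij [set: nat] S p.

Definition has_monotone_AP (l : nat) (p : nat -> int) : Prop :=
  exists (i : 'I_l -> nat) (x d : int),
    [/\ {homo i : j k / (j < k)%N},
        d != 0
      & forall j : 'I_l, p (i j) = x + (j : nat)%:Z * d].

Definition permutable (l : nat) (S : set int) : Prop :=
  infinite_set S /\
  exists2 p : nat -> int, omega_permutation S p & ~ has_monotone_AP l p.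

(* The intersection is finite, so [fset_set] does not take its junk value. *)
Definition count_upto (T : set int) (n : nat) : nat :=
  #|` fset_set (T `&` [set k : int | - n%:Z <= k <= n%:Z])|.

(* The liminf is taken in [\bar R], where it always exists. *)
Definition lower_density (R : realType) (T : set int) : \bar R :=
  limn_einf (fun n : nat => ((count_upto T n)%:R / (2 * n + 1)%:R)%:E).

(* Main.v *)
(** Fix [M = 2 ^ K] and cut the integers by residue mod [M], sign and scale
   [4 ^ e <= |x| < 4 ^ e.+1].  From each scale delete a single (residue, sign)
   class, running through the residues in bit-reversed order, for one sign and
   then for the other.  What is left has density [1 - 1 / (2 * M)] and falls into finite
   blocks, alternately positive and negative, which are enumerated one after the
   other, each in bit-reversed order.  If [2 ^ v] exactly divides the difference
   of a progression, then bit [v] of its terms flips at each step that keeps the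
   sign; bit reversal forbids a step from 1 to 0 inside a block, and the staggered
   gaps make such a step between blocks multiply the size by more than 4.  Going
   through the sign patterns, no progression of length 4 survives.

   Only the value of the required density matters: with [M = 2 * m] it is smaller
   than [1 - 1 / (2 * M)], because [a (c - 1) / (c (a - 1)) > 1 / 2] when [c > 2],
   and a subset of the right density is obtained by thinning out evenly. *)

Require Import Defs.
From mathcomp Require Import all_boot all_order all_algebra finmap.
From mathcomp Require Import boolp classical_sets functions cardinality.
From mathcomp Require Import reals ereal topology normedtype sequences.
From mathcomp Require Import zify lra ring.
Import Order.TTheory GRing.Theory Num.Theory.
Import numFieldNormedType.Exports.

(** * Bit reversal of natural numbers *)

Fixpoint rev_bits (N n : nat) : nat :=
  if N is N'.+1 then odd n * 2 ^ N' + rev_bits N' n./2 else 0.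

Lemma rev_bits_lt N n : rev_bits N n < 2 ^ N.
Proof.
elim: N n => [|N IH] n //=; have := IH n./2.
by rewrite expnS; case: (odd n); lia.
Qed.

Lemma rev_bits_inj N n n' :
  n < 2 ^ N -> n' < 2 ^ N -> rev_bits N n = rev_bits N n' -> n = n'.
Proof.
elim: N n n' => [|N IH] n n' /=; first by rewrite expn0; lia.
rewrite expnS => ltn ltn' eqr.
have r := rev_bits_lt N n./2; have r' := rev_bits_lt N n'./2.
have eqo : odd n = odd n' by move: eqr; case: (odd n); case: (odd n'); lia.
have eqh : n./2 = n'./2 by apply: IH; [lia|lia|move: eqr; rewrite eqo; lia].
by rewrite -(odd_double_half n) -(odd_double_half n') eqo eqh.
Qed.

Lemma rev_bits_addl N n j : rev_bits N (2 ^ N * j + n) = rev_bits N n.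
Proof.
elim: N n => [|N IH] n //=.
by rewrite expnS -mulnA oddD mul2n odd_double halfD odd_double doubleK addFb IH.
Qed.

(** Reversal makes the lowest bits the most significant: the common low [v] bits cancel, and bit
    [v], set only in [n], decides. *)
Lemma leq_rev_bits N v n n' : n = n' %[mod 2 ^ v] ->
  odd (n %/ 2 ^ v) -> ~~ odd (n' %/ 2 ^ v) -> rev_bits N n' <= rev_bits N n.
Proof.
elim: N v n n' => [|N IH] [|v] n n' //=.
  rewrite expn0 !divn1 => _ -> /negbTE ->.
  by have := rev_bits_lt N n'./2; lia.
rewrite expnS => eqm; rewrite !divnMA !divn2 => on on'.
have -> : odd n = odd n'.
  by have /(congr1 odd) := eqm; rewrite !odd_mod // oddM.
rewrite leq_add2l; apply: IH on on'.
by rewrite -!divn2 !modn_divl mulnC eqm.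
Qed.

(* [Posz n] and [Negz n = - n.+1] get the same magnitude: the construction is
   symmetric about -1/2, and bits of negative integers are those of the
   complement, so negative blocks are ordered against positive ones. *)
Definition mag (x : int) : nat := match x with Posz n => n | Negz n => n end.
Definition neg (x : int) : bool := if x is Negz _ then true else false.

(** * Blocks, keys and progressions of length four *)

Section Blocks.
Variable K : nat.
Local Notation M := (2 ^ K).
Local Notation Q := (2 * 2 ^ K).

(* [trunc_log 4 0 = 0], so 0 and -1 count as having scale 0. *)
Definition level (x : int) : nat :=
  trunc_log 4 (mag x) + rev_bits K (mag x) + neg x * M.
Definition kept (x : int) : bool := level x %% Q != Q.-1.
Definition block (x : int) : nat := (level x %/ Q).*2 + ~~ neg x.
(* Block [z] only contains magnitudes below [2 ^ depth z], so [key] sorts by block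
   first and by reversed bits inside a block. *)
Definition depth (z : nat) : nat := Q * (z + 2).
Definition key (x : int) : nat :=
  2 ^ depth (block x) + rev_bits (depth (block x)) (mag x).

Lemma leq_exp_trunc_log n k : k < trunc_log 4 n -> 4 ^ k.+1 <= n.
Proof.
move=> ltk; have n_gt0 : 0 < n by case: n ltk.
by apply: leq_trans (trunc_logP (isT : 1 < 4) n_gt0); rewrite leq_exp2l.
Qed.

(** For either sign, block [b] is a window of length [2 * M] from [(b - 1) * M] for scale plus
    reversed residue; [+ 2] instead of [+ 1] records the value that [kept] removes. *)
Lemma level_block x : kept x ->
  block x * M <= trunc_log 4 (mag x) + rev_bits K (mag x) + M /\
  trunc_log 4 (mag x) + rev_bits K (mag x) + 2 <= (block x).+1 * M.
Proof.
rewrite /kept /block => kx.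
have M0 : 0 < M by rewrite expn_gt0.
have lt := ltn_pmod (level x) (_ : 0 < Q); have := divn_eq (level x) Q.
move: (level x %/ Q) (level x %% Q) kx lt => u r kx /(_ ltac:(lia)) lt.
rewrite /level; case: (neg x); nia.
Qed.

Lemma mag_lt_depth x : mag x < 2 ^ depth (block x).
Proof.
apply: leq_trans (trunc_log_ltn _ (isT : 1 < 4)) _.
have -> k : 4 ^ k = 2 ^ (2 * k) by rewrite expnM.
rewrite leq_exp2l //.
have M0 : 0 < M by rewrite expn_gt0.
have lt := ltn_pmod (level x) (_ : 0 < Q); have := divn_eq (level x) Q.
rewrite /depth /block; move: (level x %/ Q) (level x %% Q) lt => u r /(_ ltac:(lia)) lt.
rewrite /level; case: (neg x); nia.
Qed.

Lemma ltn_key x y : block x < block y -> key x < key y.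
Proof.
rewrite /key => ltb; have := rev_bits_lt (depth (block x)) (mag x).
have : 2 ^ (depth (block x)).+1 <= 2 ^ depth (block y).
  have M0 : 0 < M by rewrite expn_gt0.
  by rewrite leq_exp2l // /depth; nia.
by rewrite expnS; lia.
Qed.

Lemma leq_block x y : key x <= key y -> block x <= block y.
Proof. by have [//|/ltn_key] := leqP (block x) (block y); lia. Qed.

Lemma key_inj : injective key.
Proof.
move=> x y eqk.
have eqb : block x = block y.
  by apply/eqP; rewrite eqn_leq !leq_block // eqk.
have eqm : mag x = mag y.
  apply: (@rev_bits_inj (depth (block x))); rewrite ?mag_lt_depth //.
    by rewrite eqb mag_lt_depth.
  by move: eqk; rewrite /key eqb => /addnI.
have : neg x = neg y by move: eqb; rewrite /block; case: (neg x) (neg y) => -[]; lia.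
by move: eqm; case: x {eqk eqb} => n; case: y => n' //= ->.
Qed.

Lemma mag_jump x y : kept x -> kept y -> neg x = neg y -> key x < key y ->
  (forall N, rev_bits N (mag y) <= rev_bits N (mag x)) ->
  block x < block y /\ 4 * mag x + 4 <= mag y.
Proof.
move=> kx ky eqn ltk le_rev.
have ltb : block x < block y.
  rewrite ltn_neqAle (leq_block _ _ (ltnW ltk)) andbT; apply: contraTneq ltk.
  by rewrite /key => ->; rewrite -leqNgt leq_add2l.
split=> //.
have [_ ux] := level_block _ kx; have [ly _] := level_block _ ky.
have M0 : 0 < M by rewrite expn_gt0.
(* Equal signs mean equal parity of blocks. The sum of scale and reversed residue then grows by at
   least 2, all of it from the scale. *)
have ltb2 : (block x).+2 <= block y by move: ltb; rewrite /block eqn; lia.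
have le_e : (trunc_log 4 (mag x)).+1 < trunc_log 4 (mag y).
  by have := le_rev K; nia.
have := leq_exp_trunc_log _ _ le_e; have := trunc_log_ltn (mag x) (isT : 1 < 4).
by rewrite [4 ^ _.+2]expnS; lia.
Qed.

(** Three blocks raise scale plus reversed residue by at least [M + 2], of which the residue
    supplies at most [M - 1]. *)
Lemma mag_jump3 x y : kept x -> kept y -> (block x).+3 <= block y ->
  16 * mag x + 16 <= mag y.
Proof.
move=> kx ky ltb.
have [_ ux] := level_block _ kx; have [ly _] := level_block _ ky.
have M0 : 0 < M by rewrite expn_gt0.
have le_e : (trunc_log 4 (mag x)).+2 < trunc_log 4 (mag y).
  by have := rev_bits_lt K (mag y); nia.
have := leq_exp_trunc_log _ _ le_e; have := trunc_log_ltn (mag x) (isT : 1 < 4).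
by rewrite [4 ^ _.+3]expnS [4 ^ _.+2]expnS; lia.
Qed.

Definition bit (v : nat) (x : int) : bool := odd (mag x %/ 2 ^ v).

Lemma bit_step v w x y : `|y - x|%N = 2 ^ v * w.*2.+1 ->
  if neg x == neg y then bit v y = ~~ bit v x /\ mag x = mag y %[mod 2 ^ v]
  else bit v y = bit v x.
Proof.
move=> eqd; have P0 : 0 < 2 ^ v by rewrite expn_gt0.
have shift n : odd ((n + 2 ^ v * w.*2.+1) %/ 2 ^ v) = ~~ odd (n %/ 2 ^ v).
  by rewrite addnC mulnC divnMDl // oddD /= odd_double.
have shiftm n : n + 2 ^ v * w.*2.+1 = n %[mod 2 ^ v].
  by rewrite addnC mulnC modnMDl.
have same (n n' : nat) : `|n' - n|%N = 2 ^ v * w.*2.+1 ->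
    odd (n' %/ 2 ^ v) = ~~ odd (n %/ 2 ^ v) /\ n = n' %[mod 2 ^ v].
  move=> eqn; have [le|lt] := leqP n n'.
    have -> : n' = n + 2 ^ v * w.*2.+1 by lia.
    by rewrite shift shiftm.
  have -> : n = n' + 2 ^ v * w.*2.+1 by lia.
  by rewrite shift shiftm negbK.
(* Across a sign change the remainders mod [2 ^ v] add up to [2 ^ v - 1], so the quotients have an
   even sum. *)
have opp n n' : n + n' + 1 = 2 ^ v * w.*2.+1 ->
    odd (n' %/ 2 ^ v) = odd (n %/ 2 ^ v).
  move=> eqn.
  have eq1 := divn_eq n (2 ^ v); have lt1 := ltn_pmod n P0.
  have eq2 := divn_eq n' (2 ^ v); have lt2 := ltn_pmod n' P0.
  have : n %/ 2 ^ v + n' %/ 2 ^ v = w.*2 by nia.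
  by move/(congr1 odd); rewrite oddD odd_double; case: odd; case: odd.
rewrite /bit; case: x eqd => n; case: y => n' /= eqd.
- by apply: same.
- by apply: opp; lia.
- by apply: opp; lia.
- by apply: same; lia.
Qed.

(** A quadrupling step makes [|d|] exceed three times the magnitude it leaves, so it can only start
    from the first term of its sign. *)
Lemma no_AP4 (x0 x1 x2 x3 d : int) : d != 0%R ->
  (x1 = x0 + d)%R -> (x2 = x1 + d)%R -> (x3 = x2 + d)%R ->
  kept x0 -> kept x1 -> kept x2 -> kept x3 ->
  key x0 < key x1 -> key x1 < key x2 -> key x2 < key x3 -> False.
Proof.
move=> d0 e1 e2 e3 k0 k1 k2 k3 l01 l12 l23.
have dpos : 0 < `|d|%N by rewrite absz_gt0.
have [w eqd] : exists w, `|d|%N = 2 ^ logn 2 `|d| * w.*2.+1.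
  have [//|u co eqd] := @pfactor_coprime 2 `|d|%N _ dpos.
  exists u./2; rewrite {1}eqd mulnC; congr (_ * _).
  by rewrite -[in LHS](odd_double_half u) -coprime2n co.
move: (logn 2 _) eqd => v eqd.
have step x y : (y = x + d)%R -> kept x -> kept y -> key x < key y ->
    [/\ block x <= block y, odd (block x) = ~~ neg x &
     if neg x == neg y then
       bit v y = ~~ bit v x /\
       (bit v x -> block x < block y /\ 4 * mag x + 4 <= mag y)
     else bit v y = bit v x].
  move=> eqy kx ky lxy; split; first exact/leq_block/ltnW.
    by rewrite /block oddD odd_double; case: (neg x).
  have := @bit_step v w x y; rewrite eqy addrC addKr => /(_ eqd).
  case: eqP => // eqn [eqb eqm]; split=> // bx.
  rewrite -eqy in eqm eqb eqn *; apply: mag_jump => // N.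
  by apply: (leq_rev_bits N v) => //; rewrite -/(bit v y) eqb bx.
have [b01 o0 s01] := step _ _ e1 k0 k1 l01.
have [b12 o1 s12] := step _ _ e2 k1 k2 l12.
have [b23 o2 s23] := step _ _ e3 k2 k3 l23.
have j02 := mag_jump3 _ _ k0 k2; have j13 := mag_jump3 _ _ k1 k3.
have o3 : odd (block x3) = ~~ neg x3.
  by rewrite /block oddD odd_double; case: (neg x3).
move: (block x0) (block x1) (block x2) (block x3) b01 b12 b23 o0 o1 o2 o3 s01 s12 s23 j02 j13.
move: (bit v x0) (bit v x1) (bit v x2) (bit v x3) => [] b1 b2 b3 z0 z1 z2 z3.
(* [mag_jump] needs equal signs, but a sign change moves to a block of the other
   parity, and then [mag_jump3] applies two steps apart. *)
all: clear -e1 e2 e3; case: x0 e1 => n0; case: x1 e2 => n1; case: x2 e3 => n2; case: x3 => n3 /=.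
all: move=> e1 e2 e3 b01 b12 b23 o0 o1 o2 o3; lia.
Qed.

End Blocks.

(** * Density of the kept integers *)

Definition int_code (x : int) : nat := (mag x).*2 + neg x.
Definition int_decode (i : nat) : int := if odd i then Negz i./2 else Posz i./2.

Lemma int_codeK : cancel int_code int_decode.
Proof.
move=> x; rewrite /int_decode /int_code oddD odd_double.
by case: x => n /=; rewrite ?addn0 ?addn1 /= ?doubleK ?uphalf_double.
Qed.

Lemma int_decodeK : cancel int_decode int_code.
Proof.
move=> i; rewrite /int_code /int_decode -[in RHS](odd_double_half i).
by case: (odd i) => /=; rewrite addnC.
Qed.

(** The codes list [0, -1, 1, -2, 2, ...], so [[-n, n]] is exactly the first [2 * n + 1] of them. *)
Lemma count_upto_int_code (t : pred nat) n :
  count_upto [set x | t (int_code x)]%classic n = \sum_(i < (2 * n).+1) t i.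
Proof.
rewrite /count_upto; have [N eqN] : exists N, N = (2 * n).+1 by exists (2 * n).+1.
rewrite -eqN; have -> : ([set x | t (int_code x)] `&` [set k : int | (- n%:Z <= k <= n%:Z)%R] =
    [set` [fset x in [seq int_decode i | i <- iota 0 N & t i]]%fset])%classic.
  apply/seteqP; split=> x; rewrite /= in_fset.
    move=> [tx xn]; apply/mapP; exists (int_code x); last by rewrite int_codeK.
    by rewrite mem_filter tx mem_iota /int_code; case: x xn {tx} => k /=; lia.
  move=> /mapP[i]; rewrite mem_filter mem_iota => /andP[ti lti] ->.
  by rewrite int_decodeK; split=> //; rewrite /int_decode; case: ifP => oi; lia.
rewrite set_fsetK card_fseq undup_id ?size_map ?size_filter; last first.
  by rewrite (map_inj_uniq (can_inj int_decodeK)) filter_uniq // iota_uniq.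
rewrite -sum1_count big_mkcond -[X in iota 0 X]subn0 -/(index_iota 0 N) big_mkord.
by apply: eq_bigr => i _; case: (t i).
Qed.

Section Density.
Variable K : nat.
Local Notation M := (2 ^ K).
Local Notation Q := (2 * 2 ^ K).

(* A power of 4 strictly between [M * j] and [M * j.+1] would exceed [M], hence be
   a multiple of [M]. *)
Lemma trunc_log_window j r : 0 < j -> r < M ->
  trunc_log 4 (M * j + r) = trunc_log 4 (M * j).
Proof.
move=> j0 rM; have M0 : 0 < M by rewrite expn_gt0.
apply: trunc_log_eq => //.
have lo : 4 ^ trunc_log 4 (M * j) <= M * j.
  by rewrite trunc_logP // muln_gt0 M0.
rewrite (leq_trans lo (leq_addr _ _)) /=.
have hi := trunc_log_ltn (M * j) (isT : 1 < 4).
have e4 k : 4 ^ k = 2 ^ (2 * k) by rewrite expnM.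
move: hi; rewrite e4; move: (2 * _) => k hi.
have leKk : K <= k by rewrite -(leq_exp2l _ _ (isT : 1 < 2)); nia.
move: hi; rewrite -(subnKC leKk) expnD ltn_pmul2l // => hi.
by apply: leq_trans (_ : M * j.+1 <= _); rewrite ?leq_pmul2l // mulnS; lia.
Qed.

(** The window has one scale [E] and meets every pair of residue and sign once, so [level] mod [Q]
    is a bijection and [kept] fails once. *)
Lemma sum_kept_window j : 0 < j ->
  \sum_(i < Q) kept K (int_decode (Q * j + i)) = Q.-1.
Proof.
move=> j0; have M0 : 0 < M by rewrite expn_gt0.
have Q0 : 0 < Q by lia.
pose E := trunc_log 4 (M * j).
pose g (i : 'I_Q) : 'I_Q :=
  Ordinal (ltn_pmod (E + rev_bits K i./2 + odd i * M) Q0).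
have hh i : i < Q -> i./2 < M by lia.
have g_inj : injective g.
  move=> i i' /(congr1 val) /= /eqP; rewrite -!addnA eqn_modDl.
  have r := rev_bits_lt K i./2; have r' := rev_bits_lt K i'./2.
  rewrite !modn_small; [|by case: odd; lia..].
  move=> /eqP eqr; apply: val_inj => /=.
  have eqo : odd i = odd i' by move: eqr; case: odd; case: odd; lia.
  rewrite -(odd_double_half i) -(odd_double_half i') eqo; congr (_ + _.*2).
  by apply: (rev_bits_inj K); rewrite ?hh //; move: eqr; rewrite eqo => /addIn.
rewrite (eq_bigr (fun i => (g i != Q.-1 :> nat) : nat)); last first.
  move=> i _; rewrite /kept /level /int_decode.
  have -> : odd (Q * j + i) = odd i by rewrite oddD !oddM.
  have -> : (Q * j + i)./2 = M * j + i./2 by rewrite -mulnA mul2n halfD odd_double doubleK.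
  by case: ifP => oi /=; rewrite rev_bits_addl trunc_log_window ?hh // oi.
rewrite -(@reindex_inj _ _ _ _ _ xpredT (fun i : 'I_Q => (i != Q.-1 :> nat) : nat) g_inj) /=.
rewrite -(big_mkord xpredT (fun i => (i != Q.-1) : nat)).
rewrite -[X in index_iota 0 X](prednK Q0) big_nat_recr //= eqxx addn0.
rewrite big_nat (eq_bigr (fun=> 1)) -?big_nat ?sum_nat_const_nat ?subn0 ?muln1 //.
by move=> i /andP[_ lti]; rewrite ltn_eqF.
Qed.

(** Only the window at 0, where the scale varies, and the last incomplete one are inexact; each has
    at most [Q] codes. *)
Lemma sum_kept_bound N :
  (\sum_(i < N) kept K (int_decode i)) * Q <= Q.-1 * N + 2 * Q ^ 2 /\
  Q.-1 * N <= (\sum_(i < N) kept K (int_decode i)) * Q + 2 * Q ^ 2.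
Proof.
have Q0 : 0 < Q by rewrite muln_gt0 expn_gt0.
pose c N := \sum_(i < N) kept K (int_decode i).
have cD N1 n : c (N1 + n) = c N1 + \sum_(i < n) kept K (int_decode (N1 + i)).
  by rewrite /c big_split_ord.
have le_sum N1 n : \sum_(i < n) kept K (int_decode (N1 + i)) <= n.
  rewrite -[leqRHS]card_ord -sum1_card leq_sum // => i _.
  by case: kept.
have cQ u : c (Q * u.+1) = c Q + Q.-1 * u.
  elim: u => [|u IH]; first by rewrite !muln1 muln0 addn0.
  by rewrite mulnS addnC cD IH sum_kept_window // mulnS; lia.
rewrite -/(c N); rewrite (divn_eq N Q).
have := ltn_pmod N Q0; move: (N %/ Q) (N %% Q) => u r ltr.
rewrite [u * Q]mulnC cD; have ler := le_sum (Q * u) r.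
move: (\sum_(i < r) _) ler => s ler.
have cQ0 : c Q <= Q by rewrite /c; exact: (le_sum 0 Q).
case: u => [|u]; first by rewrite muln0 /c big_ord0; nia.
rewrite cQ; move: (c Q) cQ0 => s' les'; move: Q Q0 ltr les' => q; nia.
Qed.
End Density.

(** * Enumeration by increasing key *)

Lemma increasing_enumeration (T : Type) (S : set T) (k : T -> nat) :
  injective k -> infinite_set S ->
  exists2 p : nat -> T, set_bij setT S p & {homo (k \o p) : i j / i < j}.
Proof.
move=> k_inj infS.
have next N : exists x, [/\ S x, N <= k x & forall y, S y -> N <= k y -> k x <= k y].
  have [n ex_n] : exists n, `[< exists x, [/\ S x, N <= k x & k x = n] >].
    apply: contrapT => none; apply: infS.
    apply: (@sub_finite_set _ _ (k @^-1` `I_N)%classic) => [x Sx /=|].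
      rewrite ltnNge; apply/negP => leNx; apply: none.
      by exists (k x); apply/asboolP; exists x.
    by apply: finite_preimage (finite_II N) => x y _ _; exact: k_inj.
  have ex : exists n, `[< exists x, [/\ S x, N <= k x & k x = n] >] by exists n.
  case: (ex_minnP ex) => n0 /asboolP[x [Sx leN eqx]] min.
  exists x; split=> // y Sy leNy; rewrite eqx; apply: min.
  by apply/asboolP; exists y.
have [nx nxP] := choice next.
pose p := fix p i := if i is i'.+1 then nx (k (p i')).+1 else nx 0.
have Sp i : S (p i) by case: i => [|i]; [have [] := nxP 0 | have [] := nxP (k (p i)).+1].
have p_incr : {homo (k \o p) : i j / i < j}.
  apply: homo_ltn => [|i /=]; first exact: ltn_trans.
  by have [] := nxP (k (p i)).+1.
exists p => //; split=> //.
  move=> i j _ _ eqp.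
  by have [/p_incr|/p_incr|//] := ltngtP i j; rewrite /= eqp ltnn.
(* Since [k (p i) >= i], some [p i] reaches [k x]; at the first such [i], the minimal choice of
   [p i] gives equality. *)
move=> x Sx; have ge_id i : i <= k (p i).
  by elim: i => [|i IH] //; apply: leq_ltn_trans IH (p_incr _ _ (ltnSn i)).
have ex : exists i, k x <= k (p i) by exists (k x).
case: (ex_minnP ex) => i le_i min; exists i => //; apply: k_inj.
apply/eqP; rewrite eqn_leq le_i andbT.
case: i le_i min => [|i] le_i min /=.
  by have [_ _] := nxP 0; apply.
have [_ _] := nxP (k (p i)).+1; apply=> //.
by rewrite ltnNge; apply/negP => /min; rewrite ltnn.
Qed.

Lemma permutable_kept K (S : set int) :
  infinite_set S -> (forall x, S x -> kept K x) -> permutable 4 S.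
Proof.
move=> infS keptS; split=> //.
have [p pbij p_incr] := increasing_enumeration _ _ _ (key_inj K) infS.
exists p => // -[i [x [d [i_incr d0 eqp]]]].
have Sp j : S (p j) by case: pbij => fun_p _ _; exact: fun_p.
pose o (n : nat) (h : n < 4) := i (Ordinal h).
have step (n : nat) (h : n < 4) (h' : n.+1 < 4) :
    (p (o n.+1 h') = p (o n h) + d)%R /\ key K (p (o n h)) < key K (p (o n.+1 h')).
  by split; [rewrite !eqp /= -addn1 PoszD mulrDl mul1r addrA | apply/p_incr/i_incr].
have [e1 l1] := step 0 isT isT.
have [e2 l2] := step 1 isT isT.
have [e3 l3] := step 2 isT isT.
by apply: (no_AP4 K _ _ _ _ _ d0 e1 e2 e3); rewrite ?keptS.
Qed.

Local Open Scope ring_scope.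

(** * Thinning to a prescribed density *)

Section Thinning.
Variable R : realType.

Lemma thinning (s : pred nat) (sigma delta C : R) :
  0 <= delta -> delta <= sigma -> 0 < sigma ->
  (forall N, `|(\sum_(i < N) s i)%N%:R - sigma * N%:R| <= C) ->
  exists2 t : pred nat, (forall i, t i -> s i) &
    forall N, `|(\sum_(i < N) t i)%N%:R - delta * N%:R| <= C + 1.
Proof.
move=> d0 ds s0 hs; pose c N := (\sum_(i < N) s i)%N.
pose th := delta / sigma.
have th0 : 0 <= th by rewrite divr_ge0 // ltW.
have th1 : th <= 1 by rewrite ler_pdivrMr // mul1r.
pose f n := Num.truncn (th * n%:R).
have fP n : (f n)%:R <= th * n%:R < (f n).+1%:R.
  by apply: truncn_itv; rewrite mulr_ge0.
(* Keep the n-th element of [s] when [th * n] passes an integer. *)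
exists (fun i => s i && (f (c i).+1 != f (c i))) => [i /andP[]//|N].
(* As [th <= 1], [f] grows by 0 or 1 at each element of [s], so the count telescopes. *)
have -> : (\sum_(i < N) (s i && (f (c i).+1 != f (c i))) = f (c N))%N.
  elim: N => [|N IH].
    by rewrite /c !big_ord0 /f mulr0 truncn0.
  rewrite big_ord_recr /= IH /c big_ord_recr /= -/(c N).
  case: (s N) => /=; rewrite ?addn0 // addn1.
  have /andP[lo hi] := fP (c N); have /andP[lo' hi'] := fP (c N).+1.
  have le1 : (f (c N) < (f (c N).+1).+1)%N.
    rewrite -(ltr_nat R); apply: le_lt_trans lo _; apply: le_lt_trans hi'.
    by rewrite ler_wpM2l // ler_nat.
  have le2 : (f (c N).+1 < (f (c N)).+2)%N.
    rewrite -(ltr_nat R); apply: le_lt_trans lo' _.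
    by rewrite -natr1 mulrDr mulr1 -[X in _ < X]natr1 ltr_leD.
  by case: eqVneq => [->|] /=; lia.
have /andP[lo hi] := fP (c N); have := hs N; rewrite -/(c N).
have eqd : delta = th * sigma by rewrite /th divfK // gt_eqF.
rewrite eqd -mulrA !ler_norml => /andP[h1 h2].
rewrite -natr1 in hi.
have C0 : 0 <= C by apply: le_trans (hs 0).
move: (sigma * _) h1 h2 => y h1 h2.
have : th * (c N)%:R - th * y <= C.
  by rewrite -mulrBr; apply: le_trans (ler_wpM2l th0 h2) _; rewrite ler_piMl.
have : - C <= th * (c N)%:R - th * y.
  rewrite -mulrBr; apply: le_trans (ler_wpM2l th0 h1).
  by rewrite mulrN lerN2 ler_piMl.
by move=> *; apply/andP; split; lra.
Qed.

Lemma lower_density_code (t : pred nat) (delta C : R) :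
  (forall N, `|(\sum_(i < N) t i)%N%:R - delta * N%:R| <= C) ->
  lower_density R [set x | t (int_code x)]%classic = delta%:E.
Proof.
move=> ht; have C0 : 0 <= C by apply: le_trans (ht 0).
apply: (cvg_limn_einf_sup _).1; apply: cvg_EFin; first by near=> n.
apply/cvgrPdist_le => e e0; near=> n.
have n0 : 0 < (2 * n + 1)%:R :> R by rewrite ltr0n addn1.
rewrite /= count_upto_int_code -addn1 distrC.
rewrite -[delta](mulfK (lt0r_neq0 n0)) -mulrBl normrM normfV (gtr0_norm n0).
rewrite ler_pdivrMr //; apply: le_trans (ht _) _.
rewrite mulrC -ler_pdivrMr //; apply: (@le_trans _ _ n%:R).
  by near: n; exact: nbhs_infty_ger.
by rewrite ler_nat; lia.
Unshelve. all: by end_near.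
Qed.

Lemma infinite_code (t : pred nat) (delta C : R) : 0 < delta ->
  (forall N, `|(\sum_(i < N) t i)%N%:R - delta * N%:R| <= C) ->
  infinite_set [set x | t (int_code x)]%classic.
Proof.
move=> d0 ht finT; pose B := #|` fset_set [set x | t (int_code x)]%classic|.
(* Chosen with [delta * n > B + C], to force more than [B] elements in [[-n, n]]. *)
pose n := (Num.truncn ((B%:R + C) / delta)).+1.
have : (count_upto [set x | t (int_code x)]%classic n <= B)%N.
  by apply: fsubset_leq_card; rewrite -fset_set_sub //; exact: finite_setIl.
rewrite count_upto_int_code; apply/negP; rewrite -ltnNge -(ltr_nat R).
have := ht (2 * n).+1; rewrite ler_norml => /andP[+ _].
have : (B%:R + C) / delta < n%:R by exact: truncnS_gt.
rewrite ltr_pdivrMr // => h1.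
have : n%:R * delta <= delta * (2 * n).+1%:R.
  by rewrite mulrC ler_pM2l // ler_nat; lia.
by move=> *; lra.
Qed.

End Thinning.

Theorem theorem1p2 (R : realType) (m a : nat) (c : R)
    (hm : (2 <= m)%N) (hm2 : exists k : nat, m = (2 ^ k)%N)
    (ha : (4 <= a)%N)
    (hc1 : 2 + 1 / a%:R < c) (hc2 : c < a%:R) :
  exists S : set int,
    permutable 4 S /\
    lower_density R S =
      (1 - (a%:R * (c - 1)) / (2 * m%:R * c * (a%:R - 1)))%:E.
Proof.
have [k mE] := hm2.
have a4 : (4 : R) <= a%:R by rewrite ler_nat.
have m2 : (2 : R) <= m%:R by rewrite ler_nat.
have c2 : 2 < c.
  by apply: le_lt_trans hc1; rewrite lerDl divr_ge0 // ler0n.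
pose f := (a%:R * (c - 1)) / (c * (a%:R - 1)) : R.
have -> : (a%:R * (c - 1)) / (2 * m%:R * c * (a%:R - 1)) = f / (2 * m%:R).
  by rewrite /f; field; rewrite !gt_eqF //; lra.
have den0 : 0 < c * (a%:R - 1) by rewrite mulr_gt0 //; lra.
(* Cross-multiplied, this is [c < a]; it keeps the target density positive. *)
have f1 : f < 1 by rewrite ltr_pdivrMr // mul1r; nra.
have f2 : 1 / 2 < f by rewrite ltr_pdivlMr //; nra.
have M0 : 0 < 2 * m%:R :> R by lra.
have [Q QD] : exists Q, Q = (2 * 2 ^ k.+1)%N by exists (2 * 2 ^ k.+1)%N.
have QE : Q%:R = 4 * m%:R :> R by rewrite QD mE expnS mulnA natrM.
(* Here [Q = 4 * m], and the error [2 * Q] is [2 * Q ^ 2] from [sum_kept_bound] divided by [Q]. *)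
have := @thinning R (fun i => kept k.+1 (int_decode i)) (1 - Q%:R^-1)
  (1 - f / (2 * m%:R)) (2 * Q%:R).
case.
- by rewrite subr_ge0 ler_pdivrMr // mul1r; lra.
- rewrite lerD2l lerN2 QE -[X in _ <= X]mulrC -ler_pdivrMl ?invr_gt0 // invrK.
  suff -> : 2 * m%:R * (4 * m%:R)^-1 = 1 / 2 :> R by exact: ltW.
  by field; rewrite gt_eqF //; lra.
- by rewrite subr_gt0 invf_lt1 QE; lra.
- move=> N; have [hi lo] := sum_kept_bound k.+1 N; rewrite -QD in hi lo.
  have Q0 : 0 < Q%:R :> R by rewrite QE; lra.
  have QN : Q = Q.-1.+1 by rewrite prednK // -(ltr_nat R).
  have QP : Q.-1%:R = Q%:R - 1 :> R by rewrite [in RHS]QN -natr1 addrK.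
  rewrite -(ler_nat R) natrD !natrM QP in hi.
  rewrite -(ler_nat R) natrD !natrM QP in lo.
  rewrite -(ler_pM2r Q0) -[X in _ * X](gtr0_norm Q0) -normrM mulrBl.
  have -> : (1 - Q%:R^-1) * N%:R * Q%:R = (Q%:R - 1) * N%:R :> R.
    by field; rewrite gt_eqF.
  by rewrite ler_norml; apply/andP; split; lra.
move=> t ts ht; exists [set x | t (int_code x)]%classic; split.
  apply: (permutable_kept k.+1); last by move=> x /ts; rewrite int_codeK.
  apply: infinite_code ht; rewrite subr_gt0 ltr_pdivrMr // mul1r; lra.
exact: lower_density_code ht.
Qed.
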